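(* Fix $q\in(0,1)$ and let $\Gamma_n=K_{k_n}$ be the clique on $k_n$ vertices ($2\le k_n\le n$). If $$Q_n=o\left(\frac{n^2}{k_n^2}\right),$$ then weak detection is impossible with query budget $Q_n$.
   Context: Setup. Under $\mathcal H_0$, $G$ is a random graph on $[n]=\{1,\dots,n\}$ in which each pair in $\binom{[n]}{2}$ is an edge independently with probability $q$. Under $\mathcal H_1$, a copy $\Gamma_n^\star$ is drawn uniformly from the set of all subgraphs of the complete graph on $[n]$ isomorphic to $\Gamma_n$; all edges of $\Gamma_n^\star$ are in $G$, and every other pair is an edge independently with probability $q$. For a query set $\mathcal Q\subseteq\binom{[n]}{2}$ (chosen non-adaptively), the transcript is $G_{\mathcal Q}=(\mathbf 1\{e\in e(G)\})_{e\in\mathcal Q}$, with laws $\mathbb P_{\mathcal H_0,\mathcal Q}$, $\mathbb P_{\mathcal H_1,\mathcal Q}$. The optimal risk under budget $Q_n$ is $R^\star_{n,Q_n}=1-\sup_{|\mathcal Q|\le Q_n} d_{\mathrm{TV}}(\mathbb P_{\mathcal H_1,\mathcal Q},\mathbb P_{\mathcal H_0,\mathcal Q})$. Weak detection is impossible with budget $Q_n$ if $\lim_nR^\star_{n,Q_n}=1$. *)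

(* Defs.v *)
From mathcomp Require Import all_boot all_order all_algebra.
From mathcomp Require Import all_classical all_reals all_analysis.
Import Order.TTheory GRing.Theory Num.Theory.
Import numFieldNormedType.Exports.

Set Implicit Arguments.
Unset Strict Implicit.
Unset Printing Implicit Defensive.

Local Open Scope ring_scope.
Local Open Scope classical_set_scope.

Definition vpair (n : nat) := {e : {set 'I_n} | #|e| == 2}.

(* A simple graph on all of [n], given by its edge set. *)
Definition graph (n : nat) := {set vpair n}.

Definition complete_graph (k : nat) : graph k := [set: vpair k]%SET.

Definition adj (n : nat) (E : graph n) (i j : 'I_n) : bool :=
  [exists e in E, val e == [set i; j]%SET].

Definition is_subgraph (n : nat) (H : {set 'I_n} * graph n) : bool :=
  [forall e in H.2, val e \subset H.1].

Definition isomorphic (m n : nat) (Gam : graph m)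
    (H : {set 'I_n} * graph n) : bool :=
  [exists f : {ffun 'I_m -> 'I_n},
    [&& injectiveb f, [set f i | i in 'I_m]%SET == H.1
      & [forall i, forall j, adj Gam i j == adj H.2 (f i) (f j)]]].

(* A subgraph of the complete graph on [n] is a pair (vertex set, edge set). *)
Definition copies (m n : nat) (Gam : graph m) : {set {set 'I_n} * graph n} :=
  [set H | is_subgraph H && isomorphic Gam H]%SET.

(* Laws on a finite type are represented by their mass functions. *)
Definition null_law (R : realType) (n : nat) (q : R) (G : graph n) : R :=
  \prod_(e : vpair n) (if e \in G then q else 1 - q).

Definition planted_law (R : realType) (n : nat) (q : R) (E G : graph n) : R :=
  \prod_(e : vpair n)
    (if e \in E then (e \in G)%:R else if e \in G then q else 1 - q).

Definition alt_law (R : realType) (m n : nat) (Gam : graph m) (q : R)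
    (G : graph n) : R :=
  #|copies n Gam|%:R^-1 * \sum_(H in copies n Gam) planted_law q H.2 G.

Definition transcript (n : nat) (Q : {set vpair n}) (G : graph n) :
    {ffun {e : vpair n | e \in Q} -> bool} :=
  [ffun e => val e \in G].

Definition transcript_law (R : realType) (n : nat) (P : graph n -> R)
    (Q : {set vpair n}) (t : {ffun {e : vpair n | e \in Q} -> bool}) : R :=
  \sum_(G : graph n | transcript Q G == t) P G.

Definition dTV (R : realType) (T : finType) (P1 P0 : T -> R) : R :=
  \big[Num.max/0]_(A : {set T}) `|\sum_(x in A) P1 x - \sum_(x in A) P0 x|.

(* Both this maximum and the one in [dTV] range over nonempty finite families
   of nonnegative reals, so the default value 0 has no effect. *)
Definition optimal_risk (R : realType) (m n : nat) (Gam : graph m) (q : R)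
    (b : nat) : R :=
  1 - \big[Num.max/0]_(Q : {set vpair n} | (#|Q| <= b)%N)
        dTV (transcript_law (alt_law Gam q) (Q := Q))
            (transcript_law (null_law q) (Q := Q)).

Definition weak_detection_impossible (R : realType) (q : R) (k : nat -> nat)
    (Gam : forall n, graph (k n)) (b : nat -> nat) : Prop :=
  optimal_risk n (Gam n) q (b n) @[n --> \oo] --> (1 : R).

(* Main.v *)
Require Import Defs.
From mathcomp Require Import all_boot all_order all_algebra.
From mathcomp Require Import all_classical all_reals all_analysis.
From mathcomp Require Import zify.
Import Order.TTheory GRing.Theory Num.Theory.
Import numFieldNormedType.Exports.

(** If the planted edge set misses the query set, the transcript has the same
    law as under the null. Hence the total variation distance is at most the
    probability that the planted clique contains a queried pair, which by a
    union bound is at most [|Q| k (k - 1) / (n (n - 1)) <= |Q| k^2 / n^2]. *)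

Set Implicit Arguments.
Unset Strict Implicit.
Unset Printing Implicit Defensive.

Local Open Scope ring_scope.
Local Open Scope classical_set_scope.

(** * Product laws on graphs and the laws of their transcripts *)

(** The factor at one pair, taken as a function of that pair's status, so that the null and planted
    laws both have the form [\prod_e w e (e \in G)]. *)
Definition edge_weight (R : realType) {n : nat} (q : R) (E : graph n)
    (e : vpair n) (b : bool) : R :=
  if e \in E then b%:R else if b then q else 1 - q.

Lemma planted_lawE (R : realType) (n : nat) (q : R) (E G : graph n) :
  planted_law q E G = \prod_e edge_weight q E e (e \in G).
Proof. by []. Qed.

Lemma null_lawE (R : realType) (n : nat) (q : R) :
  @null_law R n q =1 planted_law q finset.set0.
Proof.
by move=> G; apply: eq_bigr => e _; rewrite finset.in_set0.
Qed.

Lemma sum_graph_prod (R : realType) (n : nat) (w : vpair n -> bool -> R) :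
  \sum_(G : graph n) \prod_e w e (e \in G) = \prod_e (w e true + w e false).
Proof.
rewrite bigA_distr; apply: eq_bigr => G _; apply: eq_bigr => e _.
by case: (e \in G).
Qed.

Lemma edge_weight_sum (R : realType) (n : nat) (q : R) (E : graph n) e :
  edge_weight q E e true + edge_weight q E e false = 1.
Proof.
by rewrite /edge_weight; case: (e \in E); rewrite ?addr0// addrC subrK.
Qed.

Lemma sum_planted_law (R : realType) (n : nat) (q : R) (E : graph n) :
  \sum_G planted_law q E G = 1.
Proof.
rewrite (sum_graph_prod (edge_weight q E)) big1// => e _.
exact: edge_weight_sum.
Qed.

Lemma planted_law_ge0 (R : realType) (n : nat) (q : R) (E G : graph n) :
  0 < q < 1 -> 0 <= planted_law q E G.
Proof.
move=> /andP[q0 q1]; apply: prodr_ge0 => e _.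
case: ifP => _; first exact: ler0n.
by case: ifP => _; rewrite ?subr_ge0 ltW.
Qed.

(** Pairs are independent under a product law: an observed pair keeps its factor at the observed
    value, and an unobserved one is summed out. *)
Lemma transcript_lawE (R : realType) (n : nat) (w : vpair n -> bool -> R)
    (Q : {set vpair n}) (t : {ffun {e : vpair n | e \in Q} -> bool}) :
  transcript_law (fun G => \prod_e w e (e \in G)) t =
  \prod_e (if insub e is Some e' then w e (t e') else w e true + w e false).
Proof.
(* The indicator of the event that the transcript equals [t] is itself a product over pairs, with
   factor 1 off [Q]. *)
pose c e (b : bool) : R :=
  if insub e is Some e' then (b == t e')%:R else 1.
have cE G : (transcript Q G == t)%:R = \prod_e c e (e \in G).
  case: eqP => [tE|ne].
    rewrite big1// => e _; rewrite /c; case: insubP => //= e' _ <-.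
    by rewrite -tE ffunE eqxx.
  have [e' he'] : exists e', val e' \in G != t e' :> bool.
    apply/existsP; rewrite -negb_forall; apply/negP => /forallP h.
    by apply: ne; apply/ffunP => e'; rewrite ffunE; apply/eqP.
  by rewrite (bigD1 (val e'))//= {1}/c valK (negbTE he') mul0r.
rewrite /transcript_law big_mkcond /=.
transitivity (\sum_(G : graph n) \prod_e (w e (e \in G) * c e (e \in G))).
  apply: eq_bigr => G _; rewrite big_split/= -cE.
  by case: eqP; rewrite ?mulr1 ?mulr0.
rewrite (sum_graph_prod (fun e b => w e b * c e b)); apply: eq_bigr => e _.
rewrite /c; case: insubP => [e' _ _|_]; last by rewrite !mulr1.
by case: (t e'); rewrite mulr1 mulr0 ?addr0 ?add0r.
Qed.

(** Unqueried weights sum to 1 whatever [E] is, and on queried pairs, all outside [E], the planted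
    weight is the null one. *)
Lemma transcript_law_disjoint (R : realType) (n : nat) (q : R) (E : graph n)
    (Q : {set vpair n}) (t : {ffun {e : vpair n | e \in Q} -> bool}) :
  [disjoint E & Q]%B ->
  transcript_law (planted_law q E) t = transcript_law (@null_law R n q) t.
Proof.
move=> dEQ.
have -> : transcript_law (@null_law R n q) t =
          transcript_law (planted_law q finset.set0) t.
  by apply: eq_bigr => G _; rewrite null_lawE.
rewrite !(transcript_lawE (edge_weight q _)); apply: eq_bigr => e _.
case: insubP => [e' eQ _|_]; last by rewrite !edge_weight_sum.
by rewrite /edge_weight (disjointFl dEQ eQ) finset.in_set0.
Qed.

Lemma transcript_law_prob (R : realType) (n : nat) (q : R) (E : graph n)
    (Q : {set vpair n}) (A : {set {ffun {e : vpair n | e \in Q} -> bool}}) :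
  0 < q < 1 ->
  0 <= \sum_(t in A) transcript_law (planted_law q E) t <= 1.
Proof.
move=> hq; have pos t : 0 <= transcript_law (planted_law q E) (Q := Q) t.
  by apply: sumr_ge0 => G _; exact: planted_law_ge0.
apply/andP; split; first exact: sumr_ge0.
rewrite -(sum_planted_law q E) (partition_big (@transcript n Q) xpredT)//=.
by rewrite [leRHS](bigID (mem A))/= lerDl; apply: sumr_ge0 => t _; exact: pos.
Qed.

(** The alternative is a uniform mixture over copies, so the triangle inequality applies copy by
    copy: a copy missing [Q] contributes 0, any other at most 1. *)
Lemma dTV_alt_law_le (R : realType) (m n : nat) (Gam : graph m) (q : R)
    (Q : {set vpair n}) :
  0 < q < 1 -> (0 < #|copies n Gam|)%N ->
  dTV (transcript_law (alt_law Gam q) (Q := Q))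
      (transcript_law (null_law q) (Q := Q)) <=
  #|copies n Gam|%:R^-1 *
    #|[set H in copies n Gam | ~~ [disjoint H.2 & Q]%B]%SET|%:R.
Proof.
move=> hq N0; apply: bigmax_le => [|A _].
  by rewrite mulr_ge0// invr_ge0.
have N0' : #|copies n Gam|%:R != 0 :> R by rewrite pnatr_eq0 -lt0n.
pose p0 : R := \sum_(t in A) transcript_law (@null_law R n q) t.
pose p1 E : R := \sum_(t in A) transcript_law (@planted_law R n q E) t.
have -> : \sum_(t in A) transcript_law (@alt_law R m n Gam q) t =
          #|copies n Gam|%:R^-1 * \sum_(H in copies n Gam) p1 H.2.
  rewrite exchange_big/= mulr_sumr; apply: eq_bigr => t _.
  by rewrite /transcript_law exchange_big/= mulr_sumr.
(* The null probability is written as an average of a constant over the copies, to be subtracted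
   termwise. *)
have -> : \sum_(t in A) transcript_law (@null_law R n q) t =
          #|copies n Gam|%:R^-1 * \sum_(H in copies n Gam) p0.
  by rewrite sumr_const -[p0 *+ _]mulr_natl mulrA mulVf// mul1r.
rewrite -mulrBr normrM ger0_norm ?invr_ge0// ler_wpM2l ?invr_ge0//.
rewrite -sumrB -sum1_card natr_sum.
rewrite (eq_bigl (fun H => (H \in copies n Gam) && ~~ [disjoint H.2 & Q]%B));
  last by move=> H; rewrite finset.inE.
rewrite [leRHS]big_mkcondr/=; apply: le_trans (ler_norm_sum _ _ _) _.
apply: ler_sum => H _; case: ifPn => [_|/negPn dHQ]; last first.
  rewrite /p1 (eq_bigr _ (fun t _ => transcript_law_disjoint _ t dHQ)).
  by rewrite subrr normr0.
have /andP[a0 a1] := transcript_law_prob H.2 A hq.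
have /andP[b0 b1] := transcript_law_prob finset.set0 A hq.
have p0E : p0 = p1 finset.set0.
  by apply: eq_bigr => t _; apply: eq_bigr => G _; rewrite null_lawE.
rewrite p0E ler_norml lerBrDr lerBlDr; apply/andP; split.
  by apply: le_trans a0; rewrite addrC subr_le0.
by apply: le_trans a1 _; rewrite lerDl.
Qed.

(** * Counting the copies of a clique that meet the query set *)

Definition clique_on {n : nat} (S : {set 'I_n}) : {set 'I_n} * graph n :=
  (S, [set e : vpair n | val e \subset S]%SET).

Lemma adj_clique_on (n : nat) (S : {set 'I_n}) (x y : 'I_n) :
  x \in S -> y \in S -> adj (clique_on S).2 x y = (x != y).
Proof.
move=> xS yS; apply/existsP/idP => [[e /andP[_ /eqP exy]]|xy].
  by have := valP e; rewrite /= exy cards2; case: (x != y).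
have xy2 : #|[set x; y]%SET| == 2%N by rewrite cards2 xy.
exists (Sub [set x; y]%SET xy2).
by rewrite finset.inE SubK eqxx andbT finset.subUset !finset.sub1set xS yS.
Qed.

Lemma adj_complete_graph (k : nat) (i j : 'I_k) :
  adj (complete_graph k) i j = (i != j).
Proof.
have -> : complete_graph k = (clique_on [set: 'I_k]%SET).2.
  by apply/finset.setP => e; rewrite !finset.inE finset.subsetT.
by rewrite adj_clique_on ?finset.inE.
Qed.

Lemma copies_complete_graph (k n : nat) :
  copies n (complete_graph k) =
  (clique_on @: [set S : {set 'I_n} | #|S| == k])%SET.
Proof.
apply/finset.setP => H; rewrite finset.inE; apply/andP/imsetP.
  case: H => S E [/forallP sub /existsP[f /and3P[/injectiveP fI /eqP/= fS /= fE]]].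
  exists S; first by rewrite finset.inE -fS card_imset// card_ord.
  congr pair; apply/finset.setP => e; rewrite finset.inE.
  apply/idP/idP => [eE|eS]; first by have := sub e; rewrite /= eE.
  have /cards2P[x [y [xy exy]]] := valP e.
  have := eS; rewrite exy finset.subUset !finset.sub1set -fS.
  case/andP => /imsetP[i _ xi] /imsetP[j _ yj].
  (* The endpoints of [e] are images of distinct, hence adjacent, vertices, so [H] has an edge with
     these endpoints, which can only be [e]. *)
  move/forallP/(_ i)/forallP/(_ j)/eqP: fE; rewrite adj_complete_graph.
  rewrite -(inj_eq fI) -xi -yj xy => /esym/existsP[e' /andP[e'E /eqP e'xy]].
  by rewrite (_ : e = e')//; apply: val_inj; rewrite e'xy.
case=> S; rewrite finset.inE => /eqP Sk ->; split.
  by apply/forallP => e; apply/implyP; rewrite finset.inE.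
(* Conversely, any enumeration of [S] is an isomorphism onto the clique on [S]. *)
subst k; apply/existsP; exists [ffun i => enum_val i].
have fI : injective [ffun i : 'I_#|S| => enum_val i].
  by move=> i j; rewrite !ffunE; exact: enum_val_inj.
apply/and3P; split; first exact/injectiveP.
  rewrite eqEcard card_imset// card_ord leqnn andbT.
  by apply/fintype.subsetP => _ /imsetP[i _ ->]; rewrite ffunE enum_valP.
apply/forallP => i; apply/forallP => j.
rewrite adj_complete_graph adj_clique_on ?ffunE ?enum_valP//.
by rewrite (inj_eq enum_val_inj).
Qed.

Lemma clique_on_inj (n : nat) : injective (@clique_on n).
Proof. by move=> S T []. Qed.

Lemma card_copies_complete_graph (k n : nat) :
  #|copies n (complete_graph k)| = 'C(n, k).
Proof.
rewrite copies_complete_graph card_imset; last exact: clique_on_inj.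
by rewrite card_draws card_ord.
Qed.

(** Deleting the two endpoints of [e] maps these cliques injectively to [k]-subsets of the remaining
    [n.-2] vertices. Writing the clique size as [k.+2] avoids truncated subtraction. *)
Lemma card_copies_complete_graph_edge (k n : nat) (e : vpair n) :
  (#|[set H in copies n (complete_graph k.+2) | e \in H.2]%SET|
   <= 'C(n.-2, k))%N.
Proof.
have -> : n.-2 = #|~: val e|%SET.
  by rewrite cardsCs finset.setCK card_ord (eqP (valP e)) subn2.
rewrite -cards_draws copies_complete_graph.
pose rest (H : {set 'I_n} * graph n) := (H.1 :\: val e)%SET.
have restI : {in [set H in clique_on @: [set S : {set 'I_n} | #|S| == k.+2]%SET
    | e \in H.2]%SET &, injective rest}.
  move=> H1 H2; rewrite !finset.inE.
  move=> /andP[/imsetP[S1 _ ->]]; rewrite finset.inE => e1.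
  move=> /andP[/imsetP[S2 _ ->]]; rewrite finset.inE => e2.
  rewrite /rest /= => eq12; congr clique_on.
  (* Each vertex set contains [val e], so it is recovered from what is left after the deletion. *)
  by rewrite -(finset.setID S1 (val e)) -(finset.setID S2 (val e)) eq12
    !(finset.setIidPr _).
rewrite -(card_in_imset restI); apply: subset_leq_card.
apply/fintype.subsetP => _ /imsetP[H + ->].
rewrite !finset.inE => /andP[/imsetP[S + ->]]; rewrite !finset.inE => /eqP Sk eS.
rewrite /rest /= finset.setDE finset.subsetIr/= -finset.setDE.
by rewrite cardsD (finset.setIidPr eS) Sk (eqP (valP e)) subn2.
Qed.

(** Union bound over the queried pairs. *)
Lemma card_copies_complete_graph_meeting (k n : nat) (Q : {set vpair n}) :
  (#|[set H in copies n (complete_graph k.+2) | ~~ [disjoint H.2 & Q]%B]%SET|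
   <= #|Q| * 'C(n.-2, k))%N.
Proof.
pose C e := [set H in copies n (complete_graph k.+2) | e \in H.2]%SET.
apply: (@leq_trans #|\bigcup_(e in Q) C e|%SET).
  apply/subset_leq_card/fintype.subsetP => H; rewrite finset.inE.
  case/andP => Hc /pred0Pn[e /andP[/= eH eQ]].
  by apply/bigcupP; exists e => //; rewrite finset.inE Hc.
apply: (@leq_trans (\sum_(e in Q) #|C e|)).
  elim/big_rec2: _ => [|e B c _ le_Bc]; first by rewrite finset.cards0.
  by rewrite (leq_trans (leq_card_setU _ _))// leq_add2l.
rewrite -sum_nat_const; apply: leq_sum => e _.
exact: card_copies_complete_graph_edge.
Qed.

Lemma bin_ratio_le (k n : nat) :
  (k.+2 <= n)%N -> ('C(n.-2, k) * n ^ 2 <= 'C(n, k.+2) * k.+2 ^ 2)%N.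
Proof.
case: n => [//|[//|n]] /=; rewrite !ltnS => kn.
(* The absorption identity for binomials, used twice. *)
have eqb : (n.+2 * n.+1 * 'C(n, k) = k.+2 * k.+1 * 'C(n.+2, k.+2))%N.
  have := mul_bin_diag n.+2 k.+1; have := mul_bin_diag n.+1 k => /= h1 h2.
  by rewrite -mulnA h1 mulnCA h2 mulnA [in LHS](mulnC k.+1).
(* This amounts to [k <= n]; it replaces the exact ratio of falling factorials by a ratio of
   squares. *)
have le1 : (n.+2 * k.+1 <= k.+2 * n.+1)%N by nia.
rewrite -(leq_pmul2r (ltn0Sn n)).
have -> : ('C(n, k) * n.+2 ^ 2 * n.+1 =
           'C(n.+2, k.+2) * k.+2 * (n.+2 * k.+1))%N by nia.
have -> : ('C(n.+2, k.+2) * k.+2 ^ 2 * n.+1 =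
           'C(n.+2, k.+2) * k.+2 * (k.+2 * n.+1))%N by nia.
by rewrite leq_mul2l le1 orbT.
Qed.

Lemma optimal_risk_complete_graph (R : realType) (n k b : nat) (q : R) :
  0 < q < 1 -> (2 <= k <= n)%N ->
  `|1 - optimal_risk n (complete_graph k) q b|
    <= b%:R / (n%:R ^+ 2 / k%:R ^+ 2).
Proof.
case: k => [//|[//|k]] hq /= kn; rewrite /optimal_risk opprB addrC subrK.
have N0 : (0 < #|copies n (complete_graph k.+2)|)%N.
  by rewrite card_copies_complete_graph bin_gt0.
have n0 : (0 < n)%N by apply: leq_trans kn.
(* The first goal concerns the default value 0 of the maximum. *)
rewrite ger0_norm ?bigmax_ge_id//; apply: bigmax_le => [|Q Qb].
  by rewrite !(mulr_ge0, invr_ge0, exprn_ge0).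
apply: le_trans (dTV_alt_law_le _ hq N0) _.
(* Clearing denominators leaves an inequality of natural numbers, the product of the union bound and
   the binomial ratio bound. *)
rewrite invf_div mulrA ler_pdivlMr ?exprn_gt0 ?ltr0n//.
rewrite -mulrA ler_pdivrMl ?ltr0n// -!natrX -!natrM ler_nat.
rewrite card_copies_complete_graph mulnCA.
apply: leq_trans (leq_mul Qb (bin_ratio_le kn)); rewrite mulnA leq_mul2r.
by rewrite card_copies_complete_graph_meeting orbT.
Qed.

Theorem corollary7 (R : realType) (q : R) (hq : 0 < q < 1)
    (k : nat -> nat) (hk : forall n : nat, (2 <= n)%N -> (2 <= k n <= n)%N)
    (Qn : nat -> nat)
    (hQ : (fun n : nat => (Qn n)%:R : R) =o_\oo
          (fun n : nat => n%:R ^+ 2 / (k n)%:R ^+ 2 : R)) :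
  weak_detection_impossible q (fun n => complete_graph (k n)) Qn.
Proof.
apply/cvgrPdist_le => eps eps0; move/eqoP: hQ => /(_ eps eps0) hQ.
(* The bounds on [k n] are given only for [2 <= n], which holds eventually. *)
near=> n; have n2 : (2 <= n)%N by near: n; exact: nbhs_infty_ge.
have /andP[k2 kn] := hk n n2.
apply: le_trans (optimal_risk_complete_graph _ hq (hk n n2)) _.
have r0 : 0 < n%:R ^+ 2 / (k n)%:R ^+ 2 :> R.
  by rewrite divr_gt0 ?exprn_gt0// ltr0n (leq_trans _ n2, leq_trans _ k2).
rewrite ler_pdivrMr// -[leLHS]ger0_norm// -[in leRHS](gtr0_norm r0).
by near: n.
Unshelve. all: by end_near. Qed.
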